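(* Let $E$ be a subset of $\mathbb{R}^k$, $k\ge1$, with its Borel $\sigma$-algebra, let $(\epsilon_t)_{t\in\mathbb{Z}}$ be an i.i.d. sequence of random variables with values in a measurable space $G$, let $(x,s)\mapsto F_s(x)$ be a measurable map from $E\times G$ to $E$, and set $f_t=F_{\epsilon_t}(\cdot)$ and $f_s^t=f_t\circ f_{t-1}\circ\cdots\circ f_s$ for integers $s\le t$. Suppose that there exist a norm $|\cdot|$ on $\mathbb{R}^k$, $C>0$, $\kappa\in(0,1)$ and an integer $m\ge1$ such that: (H1) for every $x\in E$, $\mathbb{E}(|f_0(x)|)<\infty$; (H2) for all $(x,y)\in E^2$, $\mathbb{E}(|f_0(x)-f_0(y)|)\le C|x-y|$; (H3) for all $(x,y)\in E^2$, $\mathbb{E}(|f_1^m(x)-f_1^m(y)|)\le\kappa|x-y|$. Let $(X_t)_{t\in\mathbb{Z}}$ be the $E$-valued stationary process such that, for every $x\in E$ and $t\in\mathbb{Z}$, the backward iterations $f_{t-n}^t(x)$ converge almost surely and in $\mathbb{L}^1$ to $X_t$ as $n\to\infty$. Suppose that $V:E\to(0,\infty)$ is a function for which there exist $b>0$, $\overline{\kappa}\in(0,1)$ and an integer $\overline{m}\ge1$ such that for all $x\in E$, $$\mathbb{E}\left[V\left(f_1^{\overline{m}}(x)\right)\right]\le\overline{\kappa}V(x)+b.$$ If $V$ is continuous, then $\mathbb{E}[V(X_0)]<\infty$.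
   Context: By a known theorem (Wu and Shao), conditions (H1)-(H3) guarantee that the backward iterations $f_{t-n}^t(x)$ converge as $n\to\infty$, almost surely and in $\mathbb{L}^1$, to a random variable $X_t$ not depending on $x$, and that $(X_t)_{t\in\mathbb{Z}}$ is stationary, ergodic and satisfies $X_{t+1}=f_{t+1}(X_t)$; the limit is understood to take values in $E$. *)

(* Defs.v *)
From HB Require Import structures.
From mathcomp Require Import all_boot all_order all_algebra.
From mathcomp Require Import all_classical all_reals all_analysis.
Set Implicit Arguments.
Unset Strict Implicit.
Unset Printing Implicit Defensive.
Import Order.TTheory GRing.Theory Num.Theory.
Import numFieldNormedType.Exports.
Local Open Scope classical_set_scope.
Local Open Scope ring_scope.

(* A nonempty subset [E] of a topological space as a type of its own, with the
   subspace topology and the Borel sigma-algebra of that topology ([E] itself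
   need not be a Borel set). The point [e0] is there only because measurable
   types are pointed; no other use is made of it. *)
Definition state (T : Type) (E : set T) (e0 : E) : Type := E.

Section state_instances.
Context {T : topologicalType} {E : set T} (e0 : E).

HB.instance Definition _ := Topological.copy (state e0) (set_type E).
HB.instance Definition _ := isPointed.Build (state e0) e0.
HB.instance Definition _ :=
  Measurable.copy (state e0) (g_sigma_algebraType (@open (state e0))).

Definition ambient (x : state e0) : T := set_val (x : E).

End state_instances.

Definition is_norm {R : realType} {k : nat} (N : 'rV[R]_k -> R) : Prop :=
  [/\ forall x y, N (x + y) <= N x + N y,
      forall a x, N (a *: x) = `|a| * N x
    & forall x, N x = 0 -> x = 0].

Section processes.
Context {d dG : measure_display} {Omega : measurableType d}
  {G : measurableType dG} {R : realType} {P : probability Omega R}.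
Implicit Types Y : int -> {RV P >-> G}.

Definition mutually_independent Y : Prop :=
  forall (s : seq int) (A : int -> set G), uniq s ->
    (forall t, measurable (A t)) ->
    P (\bigcap_(t in [set` s]) Y t @^-1` A t)
      = (\prod_(t <- s) P (Y t @^-1` A t))%E.

Definition identically_distributed Y : Prop :=
  forall (s t : int) (A : set G), measurable A ->
    distribution P (Y s) A = distribution P (Y t) A.

Definition iid Y : Prop := mutually_independent Y /\ identically_distributed Y.

(* Strict stationarity: the finite-dimensional distributions are invariant
   under shifts of time. They are compared on measurable rectangles, which
   determine them. *)
Definition stationary Y : Prop :=
  forall (s : seq int) (h : int) (A : int -> set G),
    (forall t, measurable (A t)) ->
    P (\bigcap_(t in [set` s]) Y (t + h) @^-1` A t)
      = P (\bigcap_(t in [set` s]) Y t @^-1` A t).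

End processes.

(* [chain f s n] composes the [n.+1] maps f_(s+n) o ... o f_(s+1) o f_s. *)
Fixpoint chain {T : Type} (f : int -> T -> T) (s : int) (n : nat) : T -> T :=
  if n is n'.+1 then f (s + n%:Z) \o chain f s n' else f s.

(* f_t o f_(t-1) o ... o f_s, meaningful only when s <= t. *)
Definition flow {T : Type} (f : int -> T -> T) (s t : int) : T -> T :=
  chain f s `|t - s|%N.

(* Main.v *)
Require Import Defs.
From HB Require Import structures.
From mathcomp Require Import all_boot all_order all_algebra.
From mathcomp Require Import all_classical all_reals all_analysis.
From mathcomp Require Import measurable_realfun.
From mathcomp Require Import ring.
Import Order.TTheory GRing.Theory Num.Theory.
Import numFieldNormedType.Exports.
Local Open Scope classical_set_scope.
Local Open Scope ring_scope.

(* Let T be the transition operator of the chain. The state reached from s at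
   time u - 1 depends only on the past noise, so it is independent of eps_u, and
   by Tonelli E[h(f_s^t(x))] = (T^(t-s+1) h)(x), whatever the starting time s.
   The drift condition reads T^m' V <= kappa' V + b; iterating it gives
   T^(j m') V <= V + b / (1 - kappa') for all j. Along the times n with
   n + 1 = j m', the backward iterations f_(-n)^0(x) converge almost surely to
   X_0, hence so do their images by V, and Fatou's lemma bounds E[V(X_0)]. *)

(** * Finite-dimensional events of the noise *)

Definition cylinder {T U I : Type} (Y : I -> T -> U) (J : set I)
  (B : I -> set U) : set T := \bigcap_(t in J) Y t @^-1` B t.

Lemma measurable_cylinder {d d' : measure_display} {T : measurableType d}
    {U : measurableType d'} {I : Type} (Y : I -> {mfun T >-> U})
    (J : set I) (B : I -> set U) : finite_set J ->
  (forall t, measurable (B t)) -> measurable (cylinder (fun t => Y t) J B).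
Proof.
move=> Jfin mB; apply: fin_bigcap_measurable => // t _.
by rewrite -[X in measurable X]setTI; apply: measurable_funP.
Qed.

(** Absorbs an event at a fresh index into a cylinder, so that an independence hypothesis on
    cylinders applies to the intersection. *)
Lemma cylinder_cons {T U : Type} {I : eqType} (Y : I -> T -> U) (u : I)
    (s : seq I) (A : set U) (B : I -> set U) : u \notin s ->
  cylinder Y [set` u :: s] (fun t => if t == u then A else B t) =
  Y u @^-1` A `&` cylinder Y [set` s] B.
Proof.
move=> us; apply/seteqP; split=> w /=.
  move=> H; split; first by have := H u; rewrite /= eqxx mem_head; exact.
  move=> t /= ts; have := H t; rewrite /= in_cons ts orbT.
  case: eqP => [tu|_]; last exact.
  by move: us; rewrite -tu ts.
move=> [Hu H] t /=; rewrite in_cons; case: eqP => [->|_] //= ts.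
exact: H.
Qed.

(** * Independence of the present state from the noise to come *)

Section markov.
Context {d dS dG : measure_display} {Omega : measurableType d}
  {S : measurableType dS} {G : measurableType dG} {R : realType}
  {P : probability Omega R}.
Variable eps : int -> {RV P >-> G}.
Hypothesis eps_iid : iid eps.

(* Joint independence from (eps_t)_(t >= u), the form that is stable under one
   step of the chain. *)
Definition independent_of_future (Y : Omega -> S) (u : int) : Prop :=
  forall (A : set S) (s : seq int) (B : int -> set G),
    measurable A -> (forall t, measurable (B t)) -> uniq s ->
    (forall t, t \in s -> u <= t) ->
    (P (Y @^-1` A `&` cylinder (fun t => eps t) [set` s] B) =
     P (Y @^-1` A) * P (cylinder (fun t => eps t) [set` s] B))%E.

Lemma independent_of_future_cst (x : S) (u : int) :
  independent_of_future (cst x) u.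
Proof.
move=> A s B mA mB _ _; rewrite preimage_cst; case: ifP => _.
  by rewrite setTI probability_setT mul1e.
by rewrite set0I measure0 mul0e.
Qed.

Lemma independent_cylinder (u : int) (C : set G) (s : seq int)
    (B : int -> set G) :
  measurable C -> (forall t, measurable (B t)) -> uniq s -> u \notin s ->
  (P (eps u @^-1` C `&` cylinder (fun t => eps t) [set` s] B) =
   P (eps u @^-1` C) * P (cylinder (fun t => eps t) [set` s] B))%E.
Proof.
move=> mC mB us uns; case: eps_iid => ind _.
rewrite -(cylinder_cons (fun t => eps t))// /cylinder ind ?ind //=; first last.
- by move=> t; case: ifP.
- by rewrite uns.
rewrite big_cons eqxx; congr (_ * _)%E.
apply: eq_big_seq => t ts; case: eqP => // tu.
by move: uns; rewrite -tu ts.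
Qed.

(** As functions of [Z], both sides are measures agreeing on rectangles, so uniqueness of the
    product measure applies. The later cylinder is carried along because the induction over time
    needs it. *)
Lemma joint_law (Y : {mfun Omega >-> S}) (u : int) (s : seq int)
    (B : int -> set G) (Z : set (S * G)) :
  independent_of_future Y u -> (forall t, measurable (B t)) -> uniq s ->
  (forall t, t \in s -> u + 1 <= t) -> measurable Z ->
  (P ((fun w => (Y w, eps u w)) @^-1` Z `&`
      cylinder (fun t => eps t) [set` s] B) =
   (distribution P Y \x distribution P (eps u)) Z *
     P (cylinder (fun t => eps t) [set` s] B))%E.
Proof.
move=> indY mB us us1 mZ.
set D := cylinder _ _ _.
have mD : measurable D by apply: measurable_cylinder.
have uns : u \notin s.
  by apply/negP => /us1; rewrite gerDl ler10.
have mYe : measurable_fun [set: Omega] (fun w => (Y w, eps u w)).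
  by apply: measurable_fun_pair.
have c0 : (0 <= fine (P D))%R by apply: fine_ge0.
have PD : (fine (P D))%:E = P D by rewrite fineK// fin_num_measure.
pose c := NngNum c0.
(* The factor [P D] is absorbed into the first marginal: [m'] and [m''] are then both identified
   with the product of [m1] and [mu]. *)
pose m1 := mscale c (distribution P Y).
pose mu := distribution P (eps u).
pose m' : {measure set (S * G) -> \bar R} :=
  measure_function_pushforward__canonical__measure_function_Measure
    (mrestr P mD) mYe.
pose m'' : {measure set (S * G) -> \bar R} :=
  mscale c (distribution P Y \x mu)%E.
transitivity (m' Z) => //.
rewrite -(@product_measure_unique _ _ _ _ _ m1 mu m')//.
  rewrite (@product_measure_unique _ _ _ _ _ m1 mu m'')//.
    by rewrite /m''/= /mscale/= PD muleC.
  move=> A C mA mC; rewrite /m'' /m1/= /mscale/=.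
  by rewrite product_measure1E// muleA.
move=> A C mA mC; rewrite /m' /m1/= /pushforward /mrestr /mscale/= PD.
(* The condition on [eps u] joins the cylinder, so the independence of [Y] from all times from [u]
   on splits off [Y] at once. *)
have -> : (fun w => (Y w, eps u w)) @^-1` (A `*` C) `&` D =
    Y @^-1` A `&` cylinder (fun t => eps t) [set` u :: s]
      (fun t => if t == u then C else B t).
  by rewrite cylinder_cons// setIA.
rewrite indY//.
- by rewrite cylinder_cons// independent_cylinder// muleA muleC muleA.
- by move=> t; case: ifP.
- by rewrite /= uns.
- move=> t; rewrite in_cons => /orP[/eqP->//|/us1].
  by apply: le_trans; rewrite lerDl.
Qed.

Lemma joint_distribution (Y : {mfun Omega >-> S}) (u : int) (Z : set (S * G)) :
  independent_of_future Y u -> measurable Z ->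
  (P ((fun w => (Y w, eps u w)) @^-1` Z) =
   (distribution P Y \x distribution P (eps u)) Z)%E.
Proof.
move=> indY mZ; have := joint_law Y u [::] (fun _ => setT) Z indY _ _ _ mZ.
by rewrite /cylinder bigcapT// setIT probability_setT mule1; apply.
Qed.

(** * The transition operator and its iterates *)

Variable F : G -> S -> S.
Hypothesis F_meas : measurable_fun [set: S * G] (fun p => F p.2 p.1).

Definition transition (h : S -> \bar R) (x : S) : \bar R :=
  (\int[distribution P (eps 0)]_g h (F g x))%E.

Lemma independent_of_future_step (Y : {mfun Omega >-> S}) (u : int) :
  independent_of_future Y u ->
  independent_of_future (fun w => F (eps u w) (Y w)) (u + 1).
Proof.
move=> indY A s B mA mB us us1.
pose Z := (fun p : S * G => F p.2 p.1) @^-1` A.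
have mZ : measurable Z by rewrite -[Z]setTI; exact: F_meas.
have := joint_law Y u s B Z indY mB us us1 mZ.
by rewrite -joint_distribution.
Qed.

Lemma transition_ge0 (h : S -> \bar R) :
  (forall x, 0 <= h x)%E -> forall x, (0 <= transition h x)%E.
Proof. by move=> h0 x; apply: integral_ge0. Qed.

Lemma measurable_transition (h : S -> \bar R) :
  measurable_fun [set: S] h -> (forall x, 0 <= h x)%E ->
  measurable_fun [set: S] (transition h).
Proof.
move=> mh h0.
apply: (measurable_fun_fubini_tonelli_F (fun p : S * G => h (F p.2 p.1))) => //.
exact: measurableT_comp.
Qed.

(** By independence the pair [(Y, eps u)] has a product law; Tonelli integrates the noise first, and
    identical distribution replaces the law of [eps u] by that of [eps 0]. *)
Lemma integral_step (Y : {mfun Omega >-> S}) (u : int) (h : S -> \bar R) :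
  independent_of_future Y u -> measurable_fun [set: S] h ->
  (forall x, 0 <= h x)%E ->
  (\int[P]_w h (F (eps u w) (Y w)) = \int[P]_w transition h (Y w))%E.
Proof.
move=> indY mh h0.
have mYe : measurable_fun [set: Omega] (fun w => (Y w, eps u w)).
  by apply: measurable_fun_pair.
pose k := fun p : S * G => h (F p.2 p.1).
have mk : measurable_fun [set: S * G] k by exact: measurableT_comp.
have mT := measurable_transition h mh h0.
have T0 := transition_ge0 h h0.
transitivity (\int[pushforward P (fun w => (Y w, eps u w))]_p k p)%E.
  by rewrite ge0_integral_pushforward// => p _; exact: h0.
transitivity (\int[distribution P Y \x distribution P (eps u)]_p k p)%E.
  apply: eq_measure_integral => Z mZ _.
  exact: joint_distribution.
rewrite fubini_tonelli1//; last by move=> p; exact: h0.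
rewrite -(ge0_integral_distribution Y mT T0)//.
apply: eq_integral => x _; rewrite /fubini_F /transition.
apply: eq_measure_integral => A mA _.
by case: eps_iid => _; exact.
Qed.

Definition flow_rv (s : int) (n : nat) (x : S) (w : Omega) : S :=
  chain (fun t => F (eps t w)) s n x.

(** One induction proves both claims, since each step needs the previous state to be measurable and
    independent of the noise about to be applied. *)
Lemma flow_rv_spec (s : int) (n : nat) (x : S) :
  measurable_fun [set: Omega] (flow_rv s n x) /\
  independent_of_future (flow_rv s n x) (s + n%:Z + 1).
Proof.
elim: n => [|n [mY indY]].
  split; last first.
    by rewrite addr0; exact: (independent_of_future_step (cst x)
      s (independent_of_future_cst x s)).
  apply: (measurableT_comp (f := fun g => F g x)) => //.
  exact: (measurable_fun_pair2 x F_meas).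
have -> : s + n.+1%:Z = s + n%:Z + 1 by rewrite -addn1 PoszD addrA.
pose Y := mfun_Sub (mem_set mY).
have E : flow_rv s n.+1 x = fun w => F (eps (s + n%:Z + 1) w) (Y w).
  by apply/funext => w; rewrite /flow_rv/= -addn1 PoszD addrA.
rewrite E; split; last exact: (independent_of_future_step Y).
have mYe : measurable_fun [set: Omega] (fun w => (Y w, eps (s + n%:Z + 1) w)).
  exact: measurable_fun_pair.
exact: measurableT_comp F_meas mYe.
Qed.

(** Induction on [n] with [h] arbitrary: integrating out the last map replaces [h] by
    [transition h]. The exponent is [n.+1] because [chain] with parameter [n] composes [n.+1]
    maps. *)
Lemma integral_flow_rv (s : int) (n : nat) (x : S) (h : S -> \bar R) :
  measurable_fun [set: S] h -> (forall x, 0 <= h x)%E ->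
  (\int[P]_w h (flow_rv s n x w) = iter n.+1 transition h x)%E.
Proof.
elim: n h => [|n IH] h mh h0.
  rewrite (integral_step (cst x) s h (independent_of_future_cst x s))//=.
  rewrite (integral_cst P measurableT (transition h x))/=.
  by rewrite probability_setT mule1.
have [mY indY] := flow_rv_spec s n x.
rewrite iterSr -IH; [|exact: measurable_transition|exact: transition_ge0].
rewrite -(integral_step (mfun_Sub (mem_set mY)) _ h indY)//=.
by apply: eq_integral => w _; rewrite /flow_rv /= -addn1 PoszD addrA.
Qed.

Lemma iter_transition_ge0 (n : nat) (h : S -> \bar R) :
  (forall x, 0 <= h x)%E -> forall x, (0 <= iter n transition h x)%E.
Proof. by move=> h0; elim: n => //= n IH; exact: transition_ge0. Qed.

Lemma measurable_iter_transition (n : nat) (h : S -> \bar R) :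
  measurable_fun [set: S] h -> (forall x, 0 <= h x)%E ->
  measurable_fun [set: S] (iter n transition h).
Proof.
move=> mh h0; elim: n => //= n IH.
by apply: measurable_transition => //; exact: iter_transition_ge0.
Qed.

Lemma measurable_section (x : S) (h : S -> \bar R) :
  measurable_fun [set: S] h -> measurable_fun [set: G] (fun g => h (F g x)).
Proof.
move=> mh; apply: (measurableT_comp (f := h)) => //.
exact: (measurable_fun_pair2 x F_meas).
Qed.

Lemma iter_transition_le (n : nat) (h h' : S -> \bar R) :
  measurable_fun [set: S] h -> measurable_fun [set: S] h' ->
  (forall x, 0 <= h x)%E -> (forall x, h x <= h' x)%E ->
  forall x, (iter n transition h x <= iter n transition h' x)%E.
Proof.
move=> mh mh' h0 hh'.
have h'0 x : (0 <= h' x)%E by exact: le_trans (h0 x) (hh' x).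
elim: n => //= n IH x; apply: ge0_le_integral => //.
- by move=> g _; exact: iter_transition_ge0.
- exact/measurable_section/measurable_iter_transition.
- exact/measurable_section/measurable_iter_transition.
Qed.

(** The operator is additive and homogeneous on nonnegative functions, and fixes constants because
    the noise law has mass one. *)
Lemma iter_transition_affine (n : nat) (h : S -> \bar R) (a b : R) :
  measurable_fun [set: S] h -> (forall x, 0 <= h x)%E ->
  0 <= a -> 0 <= b ->
  iter n transition (fun x => a%:E * h x + b%:E)%E =
  (fun x => a%:E * iter n transition h x + b%:E)%E.
Proof.
move=> mh h0 a0 b0; elim: n => //= n ->; apply/funext => x; rewrite /transition.
have mg : measurable_fun [set: G] (fun g => iter n transition h (F g x)).
  exact/measurable_section/measurable_iter_transition.
rewrite ge0_integralD//=.
- rewrite ge0_integralZl//; last by move=> g _; exact: iter_transition_ge0.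
  by rewrite (integral_cst _ measurableT b%:E)/= probability_setT mule1.
- by move=> g _; rewrite mule_ge0//; exact: iter_transition_ge0.
- exact: measurable_funeM.
Qed.

(** The constant [b / (1 - a)] is the fixed point of [c |-> a * c + b], which makes the bound
    reproduce itself under one more drift step. *)
Lemma drift_bound (V : S -> R) (a b : R) (q : nat) :
  measurable_fun [set: S] V -> (forall x, 0 <= V x) ->
  0 <= a < 1 -> 0 <= b ->
  (forall x, iter q transition (EFin \o V) x <= (a * V x + b)%:E)%E ->
  forall (j : nat) (x : S),
    (iter (j * q) transition (EFin \o V) x <= (V x + b / (1 - a))%:E)%E.
Proof.
move=> mV V0 /andP[a0 a1] b0 drift j x.
have a1' : 0 < 1 - a by rewrite subr_gt0.
have mV' : measurable_fun [set: S] (EFin \o V) by exact/measurable_EFinP.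
have V0' y : (0 <= (EFin \o V) y)%E by rewrite lee_fin.
elim: j => [|j IH]; first by rewrite mul0n lee_fin lerDl divr_ge0// ltW.
(* The drift inequality is used on the innermost [q] iterates; the outer [j * q] iterates preserve
   it by monotonicity. *)
rewrite mulSnr iterD.
have := iter_transition_le (j * q) _
  (fun x => a%:E * (EFin \o V) x + b%:E)%E
  (measurable_iter_transition q _ mV' V0') _
  (iter_transition_ge0 q _ V0') drift x.
move=> /(_ _)/le_trans; apply.
  by apply: emeasurable_funD => //; exact: measurable_funeM.
rewrite iter_transition_affine//.
apply: (@le_trans _ _ (a%:E * (V x + b / (1 - a))%:E + b%:E)%E).
  by rewrite leeD2r// lee_wpmul2l.
rewrite lee_fin mulrDr -addrA.
have -> : a * (b / (1 - a)) + b = b / (1 - a).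
  by field; rewrite gt_eqF.
by rewrite lerD2r ler_piMl// ltW.
Qed.

End markov.

(** * Continuity and convergence in the state space *)

Lemma measurable_state_continuous {T : topologicalType} {E : set T} {e0 : E}
    {R : realType} (V : state e0 -> R) :
  continuous V -> measurable_fun [set: state e0] V.
Proof.
move=> /continuousP cV; apply: (measurability _ (RGenOpens.measurableE R)).
move=> _ [_ [a [b ->] <-]]; rewrite setTI; apply: sub_sigma_algebra.
exact/cV/interval_open.
Qed.

(** Open sets of the subspace are traces of ambient ones. This bridges convergence in the ambient
    space and continuity of [V], which is only given on [E]. *)
Lemma state_cvg {T : topologicalType} {E : set T} {e0 : E} {I : Type}
    (D : set_system I) (u : I -> state e0) (y : state e0) : Filter D ->
  ambient (u i) @[i --> D] --> ambient y -> u i @[i --> D] --> y.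
Proof.
move=> FD uy A [_ [[B Bop <-] By BA]].
have yB : nbhs (ambient y) B by rewrite nbhsE; exists B.
apply: (filterS _ (uy B yB : D (fun i => B (ambient (u i))))) => i.
exact: BA.
Qed.

(** * Fatou's lemma along an almost surely convergent sequence *)

Lemma measurable_fun_limn_einf {d : measure_display} {T : measurableType d}
    {R : realType} (u : (T -> \bar R)^nat) :
  (forall n, measurable_fun [set: T] (u n)) ->
  measurable_fun [set: T] (fun x => limn_einf (u ^~ x)).
Proof.
move=> mu.
have -> : (fun x => limn_einf (u ^~ x)) =
    (fun x => - limn_esup (fun n => - u n x))%E.
  apply/funext => x; rewrite -limn_einfN; congr limn_einf.
  by apply/funext => n /=; rewrite oppeK.
apply: measurableT_comp => //; apply: measurable_fun_limn_esup => n.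
exact: measurableT_comp.
Qed.

Lemma limn_einf_ge0 {R : realType} (u : (\bar R)^nat) :
  (forall n, 0 <= u n)%E -> (0 <= limn_einf u)%E.
Proof.
move=> u0; rewrite limn_einf_lim; apply: lime_ge; first exact: is_cvg_einfs.
by apply: nearW => n; apply: le_ereal_inf_tmp => _ [i _ <-].
Qed.

Lemma integral_limit_le {d : measure_display} {T : measurableType d}
    {R : realType} (mu : {measure set T -> \bar R}) (u : (T -> \bar R)^nat)
    (v : T -> \bar R) (M : \bar R) :
  (forall n, measurable_fun [set: T] (u n)) -> measurable_fun [set: T] v ->
  (forall n x, 0 <= u n x)%E -> (forall x, 0 <= v x)%E ->
  {ae mu, forall x, u n x @[n --> \oo] --> v x} ->
  (forall n, \int[mu]_x u n x <= M)%E ->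
  (\int[mu]_x v x <= M)%E.
Proof.
move=> mu_ mv u0 v0 uv uM.
(* The lower limit exists everywhere and equals [v] almost everywhere, so it can stand for [v] under
   the integral. *)
have -> : (\int[mu]_x v x = \int[mu]_x limn_einf (u ^~ x))%E.
  apply: ge0_ae_eq_integral => //.
  - exact: measurable_fun_limn_einf.
  - by move=> x _; exact: limn_einf_ge0.
  - by apply: filterS uv => x ux _; rewrite (cvg_limn_einf_sup ux).1.
apply: le_trans (fatou _ _ _ _) _ => //.
rewrite limn_einf_lim; apply: lime_le; first exact: is_cvg_einfs.
apply: nearW => n; apply: le_trans (uM n).
by apply: ereal_inf_lbound; exists n => /=.
Qed.

Lemma flow_addn {T : Type} (g : int -> T -> T) (s : int) (n : nat) :
  flow g s (s + n%:Z) = chain g s n.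
Proof. by rewrite /flow addrAC subrr add0r absz_nat. Qed.

Theorem lemma1 (R : realType) (k : nat) (k_ge1 : (1 <= k)%N)
  (E : set 'rV[R]_k) (e0 : E)
  (d dG : measure_display) (Omega : measurableType d) (P : probability Omega R)
  (G : measurableType dG)
  (eps : int -> {RV P >-> G}) (eps_iid : iid eps)
  (F : G -> state e0 -> state e0)
  (F_meas : measurable_fun [set: state e0 * G] (fun p => F p.2 p.1))
  (f : Omega -> int -> state e0 -> state e0)
  (fE : forall w t x, f w t x = F (eps t w) x)
  (N : 'rV[R]_k -> R) (N_norm : is_norm N)
  (C kappa : R) (C_gt0 : 0 < C) (kappa_gt0 : 0 < kappa) (kappa_lt1 : kappa < 1)
  (m : nat) (m_ge1 : (1 <= m)%N)
  (H1 : forall x : state e0, ('E_P[(fun w => N (ambient (f w 0 x)))%R] < +oo)%E)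
  (H2 : forall x y : state e0,
    ('E_P[(fun w => N (ambient (f w 0 x) - ambient (f w 0 y)))%R]
       <= (C * N (ambient x - ambient y))%:E)%E)
  (H3 : forall x y : state e0,
    ('E_P[(fun w => N (ambient (flow (f w) 1 m%:Z x)
                      - ambient (flow (f w) 1 m%:Z y)))%R]
       <= (kappa * N (ambient x - ambient y))%:E)%E)
  (X : int -> {RV P >-> state e0}) (X_stationary : stationary X)
  (X_cvg_as : forall (x : state e0) (t : int),
    {ae P, forall w,
      ambient (flow (f w) (t - n%:Z) t x) @[n --> \oo] --> ambient (X t w)})
  (X_cvg_L1 : forall (x : state e0) (t : int),
    'E_P[(fun w => N (ambient (flow (f w) (t - n%:Z) t x) - ambient (X t w)))%R]%E
      @[n --> \oo] --> 0%E)
  (V : state e0 -> R) (V_gt0 : forall x, 0 < V x)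
  (b kappa' : R) (b_gt0 : 0 < b) (kappa'_gt0 : 0 < kappa')
  (kappa'_lt1 : kappa' < 1) (m' : nat) (m'_ge1 : (1 <= m')%N)
  (V_drift : forall x : state e0,
    ('E_P[(fun w => V (flow (f w) 1 m'%:Z x))%R] <= (kappa' * V x + b)%:E)%E)
  (V_cont : continuous V) :
  ('E_P[V \o X 0%R] < +oo)%E.
Proof.
rewrite unlock.
have ? : f = (fun w t => F (eps t w)).
  by apply/funext => w; apply/funext => t; apply/funext => x; rewrite fE.
subst f.
(* Writing the period as [q.+1] matches [chain], where parameter [q] means [q.+1] maps. *)
case: m' m'_ge1 V_drift => // q _ V_drift.
have V0 x : 0 <= V x by exact: ltW.
have mV := measurable_state_continuous V V_cont.
have mV' : measurable_fun [set: state e0] (EFin \o V) by exact/measurable_EFinP.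
have V0' x : (0 <= (EFin \o V) x)%E by rewrite lee_fin.
have drift x : (iter q.+1 (transition eps F) (EFin \o V) x <=
    (kappa' * V x + b)%:E)%E.
  rewrite -(integral_flow_rv eps eps_iid F F_meas 1)//.
  apply: le_trans (V_drift x); rewrite unlock le_eqVlt; apply/orP; left.
  apply/eqP/eq_integral => w _ /=.
  by rewrite (_ : q.+1%:Z = 1 + q%:Z) ?flow_addn// -PoszD add1n.
have a01 : 0 <= kappa' < 1 by rewrite ltW.
have bound := drift_bound eps F F_meas V kappa' b q.+1 mV V0 a01 (ltW b_gt0)
  drift.
(* The backward iteration from time [- n j] to [0] composes [(n j).+1] maps, a multiple of the
   period, so [bound] applies to it. The starting point is [e0]. *)
pose n j := (j.+1 * q.+1).-1.
have nE j : (n j).+1 = (j.+1 * q.+1)%N by [].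
pose Y j := flow_rv eps F (0 - (n j)%:Z) (n j) e0.
apply: (@le_lt_trans _ _ (V e0 + b / (1 - kappa'))%:E); last exact: ltry.
apply: (integral_limit_le P (fun j w => (V (Y j w))%:E)).
- move=> j; have [mY _] :=
    flow_rv_spec eps eps_iid F F_meas (0 - (n j)%:Z) (n j) e0.
  exact: measurableT_comp mV' mY.
- exact: measurableT_comp mV' _.
- by move=> j w; rewrite lee_fin.
- by move=> w; rewrite lee_fin; exact: V0.
- apply: filterS (X_cvg_as e0 0) => w Xw.
  apply: cvg_EFin; first by apply: nearW.
  apply: (cvg_comp (Y^~ w) V); last exact: V_cont.
  apply: state_cvg.
  (* Since [n j >= j], the chosen times form a sequence tending to infinity, along which the almost
     sure convergence persists. *)
  have : n j @[j --> \oo] --> \oo.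
    apply/cvgnyPge => A; exists A => // j /= Aj.
    by rewrite (leq_trans Aj)// -ltnS nE leq_pmulr.
  move=> /cvg_comp /(_ Xw); apply: cvg_trans; apply: near_eq_cvg.
  by apply: nearW => j /=; rewrite /Y /flow_rv -flow_addn subrK.
- move=> j; rewrite (integral_flow_rv eps eps_iid F F_meas _ _ _ (EFin \o V))//.
  by rewrite nE; exact: bound.
Qed.
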